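(* Let $\overline{\bm{p}}_{sa}\in\Delta_S$ with $\overline{\bm{p}}_{sa}>\bm{0}$, and let $\bm{b}\in\mathbb{R}^S_+$ and $\beta\in\mathbb{R}_+$ satisfy $\min\{\bm{b}\}\le\beta<\bm{b}^\top\overline{\bm{p}}_{sa}$. For the variation distance $\phi(t)=|t-1|$, the projection problem $$\mathfrak{P}(\overline{\bm{p}}_{sa};\bm{b},\beta)=\min\left\{\sum_{s'\in\mathcal{S}}\overline{p}_{sas'}\,\phi\!\left(\frac{p_{sas'}}{\overline{p}_{sas'}}\right) : \bm{b}^\top\bm{p}_{sa}\le\beta,\ \bm{p}_{sa}\in\Delta_S\right\}$$ can be solved exactly (i.e., its optimal value can be computed exactly) in time $\mathcal{O}(S\log S)$.
   Context: $\mathcal{S}=\{1,\dots,S\}$; $\Delta_S=\{\bm{p}\in\mathbb{R}^S_+ : \sum_{s'}p_{s'}=1\}$; the subscript $sa$ is a fixed index (state-action pair). $\min\{\bm{b}\}$ denotes the smallest component of $\bm{b}$. Running time counts elementary operations on real numbers (arithmetic operations and comparisons), each at unit cost. *)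

(* Defs.v *)
From mathcomp Require Import all_boot all_order all_algebra.
From mathcomp Require Import all_classical all_reals all_analysis.
Set Implicit Arguments.
Unset Strict Implicit.
Unset Printing Implicit Defensive.
Import Order.TTheory GRing.Theory Num.Theory.
Import numFieldNormedType.Exports.
Local Open Scope classical_set_scope.
Local Open Scope ring_scope.

Section Projection.
Variable R : realType.

Definition dot S (u v : 'cV[R]_S) : R := (u^T *m v) ord0 ord0.

Definition simplex S : set 'cV[R]_S :=
  [set p | (forall i, 0 <= p i ord0) /\ \sum_i p i ord0 = 1].

Definition min_component n (b : 'cV[R]_n.+1) : R :=
  \big[Num.min/b ord0 ord0]_i b i ord0.

Definition phi_variation (t : R) : R := `|t - 1|.

Definition divergence (phi : R -> R) S (pbar p : 'cV[R]_S) : R :=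
  \sum_i pbar i ord0 * phi (p i ord0 / pbar i ord0).

Definition is_minimum (A : set R) (v : R) : Prop := A v /\ lbound A v.

Definition is_projection_value (phi : R -> R) S
    (pbar b : 'cV[R]_S) (beta v : R) : Prop :=
  is_minimum
    [set divergence phi pbar p | p in [set p | dot b p <= beta /\ simplex p]] v.

End Projection.

(* Programs for a real random access machine.  A machine has natural-number
   registers and arrays of real cells.  The name of an array is fixed in the
   program text, the index of a cell is read from a register, so that
   (a, x) : cell denotes entry number [register x] of array a.
   Registers only support constants, +, truncated - and comparison; there is no
   conversion between reals and naturals other than loading the constants
   k%:R of the program text. *)
Definition reg := nat.
Definition cell := (nat * reg)%type.

Inductive real_op := Add | Sub | Mul | Div.

Inductive test :=
| RegLt of reg & reg
| RealLe of cell & cell.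

Inductive prog :=
| Skip
| RegConst of reg & nat
| RegAdd of reg & reg & reg
| RegSub of reg & reg & reg
| RealConst of cell & nat
| RealCopy of cell & cell
| RealOp of real_op & cell & cell & cell
| Seq of prog & prog
| If of test & prog & prog
| While of test & prog.

Section Semantics.
Variable R : realType.

Record state := State {
  regs : nat -> nat;
  cells : nat -> nat -> R
}.

Definition get (s : state) (l : cell) : R := cells s l.1 (regs s l.2).

Definition set_reg (s : state) (x : reg) (k : nat) : state :=
  State (fun y => if y == x then k else regs s y) (cells s).

Definition set_cell (s : state) (l : cell) (r : R) : state :=
  State (regs s)
    (fun a i => if (a == l.1) && (i == regs s l.2) then r else cells s a i).

(* Division by zero is undefined: it makes the machine get stuck. *)
Definition eval_op (o : real_op) (x y : R) : option R :=
  match o with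
  | Add => Some (x + y)
  | Sub => Some (x - y)
  | Mul => Some (x * y)
  | Div => if y == 0 then None else Some (x / y)
  end.

Definition eval_test (s : state) (c : test) : bool :=
  match c with
  | RegLt x y => (regs s x < regs s y)%N
  | RealLe l m => get s l <= get s m
  end.

(* exec c s t s': started in s, the program c halts in s' after t elementary
   operations.  Every assignment and every evaluation of a test has unit cost,
   whether it concerns reals or registers. *)
Inductive exec : prog -> state -> nat -> state -> Prop :=
| ExecSkip s : exec Skip s 0 s
| ExecRegConst s x k : exec (RegConst x k) s 1 (set_reg s x k)
| ExecRegAdd s x y z :
    exec (RegAdd x y z) s 1 (set_reg s x (regs s y + regs s z)%N)
| ExecRegSub s x y z :
    exec (RegSub x y z) s 1 (set_reg s x (regs s y - regs s z)%N)
| ExecRealConst s l k : exec (RealConst l k) s 1 (set_cell s l k%:R)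
| ExecRealCopy s l m : exec (RealCopy l m) s 1 (set_cell s l (get s m))
| ExecRealOp s o l m n r :
    eval_op o (get s m) (get s n) = Some r ->
    exec (RealOp o l m n) s 1 (set_cell s l r)
| ExecSeq c1 c2 s1 s2 s3 t1 t2 :
    exec c1 s1 t1 s2 -> exec c2 s2 t2 s3 ->
    exec (Seq c1 c2) s1 (t1 + t2)%N s3
| ExecIf c c1 c2 s t s' :
    exec (if eval_test s c then c1 else c2) s t s' ->
    exec (If c c1 c2) s t.+1 s'
| ExecWhileFalse c c1 s :
    eval_test s c = false -> exec (While c c1) s 1 s
| ExecWhileTrue c c1 s1 s2 s3 t1 t2 :
    eval_test s1 c = true -> exec c1 s1 t1 s2 ->
    exec (While c c1) s2 t2 s3 ->
    exec (While c c1) s1 (t1 + t2).+1 s3.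

Lemma exec_det c s t1 s1 t2 s2 :
  exec c s t1 s1 -> exec c s t2 s2 -> t1 = t2 /\ s1 = s2.
Proof.
move=> E; elim: E t2 s2 => {c s t1 s1}; try by move=> > E; inversion E.
- move=> > Hr > E; inversion E; subst.
  by split=> //; congr set_cell; congruence.
- move=> > _ IH1 _ IH2 > E; inversion E as [| | | | | | |? ? ? ? ? ? ? E1 E2| | |].
  subst; have [? ?] := IH1 _ _ E1; subst.
  by have [? ?] := IH2 _ _ E2; subst.
- move=> > _ IH > E; inversion E as [| | | | | | | |? ? ? ? ? ? E1| |]; subst.
  by have [? ?] := IH _ _ E1; subst.
- by move=> > Hc > E; inversion E; subst => //; congruence.
- move=> > Hc _ IH1 _ IH2 > E.
  inversion E as [| | | | | | | | | |? ? ? ? ? ? ? ? E1 E2]; subst.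
    congruence.
  have [? ?] := IH1 _ _ E1; subst.
  by have [? ?] := IH2 _ _ E2; subst.
Qed.

Definition col_entry S (v : 'cV[R]_S) (i : nat) : R :=
  if insub i is Some j then v j ord0 else 0.

(* Input: register 0 holds S, arrays 0 and 1 hold pbar and b, entry 0 of
   array 2 holds beta; everything else is 0.  Output: entry 0 of array 3. *)
Definition input_state S (pbar b : 'cV[R]_S) (beta : R) : state :=
  State (fun x => if x == 0%N then S else 0%N)
        (fun a i => match a with
                    | 0%N => col_entry pbar i
                    | 1%N => col_entry b i
                    | 2%N => if i == 0%N then beta else 0
                    | _ => 0
                    end).

Definition output (s : state) : R := cells s 3 0.

End Semantics.

(* Main.v *)
Require Import Defs.
From mathcomp Require Import all_boot all_order all_algebra.
From mathcomp Require Import all_classical all_reals all_analysis.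
From mathcomp Require Import ring lra zify.
Import Order.TTheory GRing.Theory Num.Theory.
Import numFieldNormedType.Exports.
Local Open Scope classical_set_scope.
Local Open Scope ring_scope.

(* Let m be the least entry of b and D = b^T pbar - beta.  For p in the simplex
   the divergence is twice the total decrease sum_i x_i, where
   x_i = max(0, pbar_i - p_i); as the removed mass reappears at cost at least m
   per unit, feasibility forces sum_i (b_i - m) x_i >= D, and moving all of it
   to an index attaining m loses nothing.  What remains is a fractional knapsack
   (minimise sum_i x_i under 0 <= x_i <= pbar_i), solved greedily in decreasing
   order of b_i; optimality follows from a Lagrange multiplier for the knapsack
   constraint.  A bottom-up merge sort costs O(S log S), the sweep O(S). *)

Set Implicit Arguments.
Unset Strict Implicit.
Unset Printing Implicit Defensive.

(** * The greedy sweep *)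

Section Greedy.
Context {R : realType}.
Implicit Types (m D lam : R) (l : seq (R * R)).

Definition key_ge (x y : R * R) : bool := y.1 <= x.1.

Lemma key_ge_total : total key_ge.
Proof. by move=> x y; apply: le_total. Qed.

(** A record is a pair of a key [b] and a weight [p]. Records of zero gap cannot reduce [D] and are
    skipped, which also keeps the final division meaningful; that division takes the fraction of the
    last record used. *)
Fixpoint greedy m l D : R :=
  if l is (b, p) :: l' then
    if b <= m then greedy m l' D
    else if (b - m) * p <= D then p + greedy m l' (D - (b - m) * p)
    else D / (b - m)
  else 0.

(** Lets the program run its sweep to the end of the array: once [D] is covered, the remaining
    records contribute nothing. *)
Lemma greedy_0 m l : all (fun x => 0 < x.2) l -> greedy m l 0 = 0.
Proof.
elim: l => [//|[b p] l IH] /= /andP[p0 l0].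
case: (leP b m) => [_|mb]; first exact: IH.
by rewrite leNgt mulr_gt0 ?subr_gt0//= mul0r.
Qed.

(* [lam] is the inverse gap [1 / (b - m)] of the record at which the greedy
   sweep stops; strengthening by [lam0] forces it to be at least the inverse
   gap of every record already consumed. *)
Lemma greedy_dual m l D lam0 :
  sorted key_ge l -> all (fun x => m <= x.1) l -> all (fun x => 0 < x.2) l ->
  0 <= D <= \sum_(x <- l) (x.1 - m) * x.2 ->
  0 <= lam0 -> all (fun x => lam0 * (x.1 - m) <= 1) l ->
  exists2 lam, lam0 <= lam &
    greedy m l D =
    lam * D + \sum_(x <- l) x.2 * Num.min 0 (1 - lam * (x.1 - m)).
Proof.
elim: l D lam0 => [|[b p] l IH] D lam0 /=.
  rewrite big_nil => _ _ _ /le_anti <- _ _.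
  by exists lam0; rewrite // big_nil mulr0 addr0.
move=> srt /andP[mb ml] /andP[p0 pl] /andP[D0].
rewrite big_cons /= => Dle lam00 /andP[lamb laml].
have l_le_b : all (fun x => x.1 <= b) l.
  have tr : transitive key_ge by move=> x y z yx xz; apply: le_trans xz yx.
  exact: (order_path_min tr srt).
have {}srt := path_sorted srt.
case: (leP b m) => [bm|{}mb].
  have bE : b = m by apply: le_anti; rewrite bm.
  have [|lam h1 h2] := IH D lam0 srt ml pl _ lam00 laml.
    by move: Dle; rewrite bE subrr mul0r add0r D0.
  exists lam => //; rewrite big_cons /= h2 bE subrr mulr0 subr0.
  by rewrite min_l // mulr0 add0r.
have gap0 : 0 < b - m by rewrite subr_gt0.
have lam0V : lam0 <= (b - m)^-1 by rewrite -div1r ler_pdivlMr.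
have small x : x \in l -> (b - m)^-1 * (x.1 - m) <= 1.
  move=> xl; rewrite mulrC ler_pdivrMr // mul1r lerD2r.
  exact: (allP l_le_b).
case: leP => [gD|Dg].
  have [|||lam h1 h2] := IH (D - (b - m) * p) (b - m)^-1 srt ml pl.
  - by rewrite subr_ge0 gD lerBlDl.
  - by rewrite invr_ge0 ltW.
  - exact/allP.
  exists lam; first exact: le_trans h1.
  (* A fully consumed record has its minimum at [1 - lam * (b - m)], so its dual term is
     [p - lam * (b - m) * p]; the second summand cancels against the decrease of [D]. *)
  have h3 : 1 <= lam * (b - m) by rewrite -ler_pdivrMr // div1r.
  rewrite big_cons /= h2 min_r; last by rewrite subr_le0.
  by ring.
(* The sweep stops here. Later records have smaller gaps, hence nonnegative reduced cost and zero
   dual term. *)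
exists (b - m)^-1 => //.
rewrite big_cons /= mulVf ?gt_eqF // subrr minxx mulr0 add0r.
rewrite big_seq big1 ?addr0 1?mulrC // => x xl.
by rewrite min_l ?mulr0 // subr_ge0 small.
Qed.

(** Weak duality, proved term by term: [x i] times the reduced cost [1 - lam * (b i - m)] is least
    over the interval from 0 to [p i] at an endpoint chosen by the sign of that cost. *)
Lemma dual_bound (I : finType) (b p x : I -> R) m D lam :
  0 <= lam -> (forall i, 0 <= x i <= p i) ->
  D <= \sum_i (b i - m) * x i ->
  lam * D + \sum_i p i * Num.min 0 (1 - lam * (b i - m)) <= \sum_i x i.
Proof.
move=> lam0 xp Dle.
apply: le_trans (_ : lam * (\sum_i (b i - m) * x i) +
  \sum_i p i * Num.min 0 (1 - lam * (b i - m)) <= _).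
  by rewrite lerD2r ler_wpM2l.
rewrite mulr_sumr -big_split /=; apply: ler_sum => i _.
have /andP[x0 xi] := xp i.
set u := lam * (b i - m); case: (leP 0 (1 - u)) => [|/ltW] h.
  by have := mulr_ge0 x0 h; rewrite mulrA -/u; lra.
have := mulr_ge0_le0 (_ : 0 <= p i - x i) h; rewrite mulrA -/u subr_ge0 => /(_ xi).
by lra.
Qed.

(** The greedy value is attained by a feasible knapsack solution, built along the recursion; the
    knapsack constraint holds with equality. *)
Lemma greedy_primal (I : eqType) (b p : I -> R) m (s : seq I) D :
  uniq s -> (forall i, 0 < p i) -> (forall i, m <= b i) ->
  0 <= D <= \sum_(i <- s) (b i - m) * p i ->
  exists x : I -> R, [/\ forall i, 0 <= x i <= p i,
    forall i, i \notin s -> x i = 0,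
    \sum_(i <- s) x i = greedy m [seq (b i, p i) | i <- s] D &
    \sum_(i <- s) (b i - m) * x i = D].
Proof.
move=> + p0 mb; elim: s D => [|j s IH] D /=.
  rewrite big_nil => _ /le_anti <-; exists (fun=> 0); split=> [i|//||].
  - by rewrite lexx ltW.
  - by rewrite big_nil.
  - by rewrite big_nil.
move=> /andP[js us] /andP[D0]; rewrite big_cons => Dle.
(* Overriding a solution on [s] at the new index [j] leaves the sums over [s] unchanged, since [j]
   does not occur in [s]. The three branches of [greedy] differ only in the value [y]. *)
have ext (y : R) (x : I -> R) : 0 <= y <= p j -> (forall i, 0 <= x i <= p i) ->
    (forall i, i \notin s -> x i = 0) ->
  let x' i := if i == j then y else x i in
  [/\ forall i, 0 <= x' i <= p i, forall i, i \notin j :: s -> x' i = 0,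
    \sum_(i <- j :: s) x' i = y + \sum_(i <- s) x i &
    \sum_(i <- j :: s) (b i - m) * x' i =
      (b j - m) * y + \sum_(i <- s) (b i - m) * x i].
  move=> yp xp xs x'; rewrite /x'; split.
  - by move=> i; case: eqP => [->|].
  - by move=> i; rewrite inE; case: eqP => //= _; exact: xs.
  - rewrite big_cons eqxx; congr (_ + _); apply: eq_big_seq => i is_.
    by case: eqP => // ij; rewrite -ij is_ in js.
  - rewrite big_cons eqxx; congr (_ + _); apply: eq_big_seq => i is_.
    by case: eqP => // ij; rewrite -ij is_ in js.
have pj := p0 j; have mbj := mb j.
case: (leP (b j) m) => [bm|bm].
  have bE : b j = m by apply: le_anti; rewrite bm mb.
  have [|x [x1 x2 x3 x4]] := IH D us.
    by move: Dle; rewrite bE subrr mul0r add0r D0.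
  have [|||e1 e2 e3 e4] := ext 0 x => //; first by rewrite lexx ltW.
  exists (fun i => if i == j then 0 else x i); split=> //.
    by rewrite e3 x3 add0r.
  by rewrite e4 x4 mulr0 add0r.
case: leP => [gD|Dg].
  have [|x [x1 x2 x3 x4]] := IH (D - (b j - m) * p j) us.
    by rewrite subr_ge0 gD lerBlDl.
  have [|||e1 e2 e3 e4] := ext (p j) x => //; first by rewrite lexx ltW.
  exists (fun i => if i == j then p j else x i); split=> //.
    by rewrite e3 x3.
  by rewrite e4 x4 addrC subrK.
have gap0 : 0 < b j - m by rewrite subr_gt0.
have [|||e1 e2 e3 e4] := ext (D / (b j - m)) (fun=> 0) => //.
- by rewrite divr_ge0 ?(ltW gap0) //= ler_pdivrMr // mulrC ltW.
- by move=> i; rewrite lexx ltW.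
exists (fun i => if i == j then D / (b j - m) else 0); split=> //.
  by rewrite e3 big1 ?addr0.
rewrite e4 big1 ?addr0 => [|i _]; last by rewrite mulr0.
by rewrite mulrC divfK // gt_eqF.
Qed.

End Greedy.

(** * Reduction of the projection problem to the knapsack *)

Section Projection.
Context {R : realType}.
Implicit Types (S : nat).

Lemma dotE S (u v : 'cV[R]_S) : dot u v = \sum_i u i ord0 * v i ord0.
Proof. by rewrite /dot mxE; apply: eq_bigr => i _; rewrite mxE. Qed.

Lemma divergence_variation S (pbar p : 'cV[R]_S) :
  (forall i, 0 < pbar i ord0) ->
  divergence (@phi_variation R) pbar p = \sum_i `|p i ord0 - pbar i ord0|.
Proof.
move=> p0; apply: eq_bigr => i _.
rewrite /phi_variation -[X in X * _](gtr0_norm (p0 i)) -normrM.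
by rewrite mulrBr mulr1 mulrCA divff ?mulr1 // gt_eqF.
Qed.

Lemma sum_norm_simplex S (pbar p : 'cV[R]_S) : simplex pbar -> simplex p ->
  \sum_i `|p i ord0 - pbar i ord0| =
  2 * \sum_i Num.max 0 (pbar i ord0 - p i ord0).
Proof.
move=> [_ pbar1] [_ p1].
(* Pointwise, the absolute value of [p - pbar] is twice the positive part of [pbar - p] plus
   [p - pbar], and the last term sums to zero. *)
have pB : \sum_i (p i ord0 - pbar i ord0) = 0 by rewrite sumrB p1 pbar1 subrr.
rewrite -[RHS]addr0 -[X in _ + X]pB mulr_sumr -big_split /=; apply: eq_bigr => i _.
by case: (leP 0 (pbar i ord0 - p i ord0)) => h;
  [rewrite ler0_norm|rewrite gtr0_norm]; lra.
Qed.

(** Recovers indices from the sorted records, which carry only values and may coincide; the primal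
    solution has to be a function of the index. *)
Lemma perm_map_inv (I T : eqType) (f : I -> T) (s : seq I) (l : seq T) :
  perm_eq l (map f s) -> exists2 s', perm_eq s' s & l = map f s'.
Proof.
case: s => [|i s] ; first by move=> /perm_nilP ->; exists [::].
set s0 := i :: s => /(perm_iotaP (f i)) [Is pI ->].
exists (map (nth i s0) Is).
  by rewrite -{2}(mkseq_nth i s0) perm_map // -(size_map f).
rewrite -map_comp; apply/eq_in_map => k.
rewrite (perm_mem pI) mem_iota size_map => /andP[_ klt].
by rewrite (nth_map i).
Qed.

Lemma greedy_projection n (pbar b : 'cV[R]_n.+1) (beta : R) (l : seq (R * R))
    (j : 'I_n.+1) :
  simplex pbar -> (forall i, 0 < pbar i ord0) ->
  (forall i, b j ord0 <= b i ord0) ->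
  b j ord0 <= beta -> beta < dot b pbar ->
  sorted key_ge l ->
  perm_eq l [seq (b i ord0, pbar i ord0) | i <- index_enum 'I_n.+1] ->
  is_projection_value (@phi_variation R) pbar b beta
    (2 * greedy (b j ord0) l (dot b pbar - beta)).
Proof.
move=> pbarS pbar0 bj bj_beta /ltW beta_lt srt.
have [pbar_ge0 pbar1] := pbarS.
move=> /perm_map_inv[s ps lE].
set m := b j ord0; set D := dot b pbar - beta.
have sum_perm (F : 'I_n.+1 -> R) : \sum_(i <- s) F i = \sum_i F i.
  exact: perm_big.
have gapE (x : 'I_n.+1 -> R) :
    \sum_i (b i ord0 - m) * x i = \sum_i b i ord0 * x i - m * \sum_i x i.
  by rewrite mulr_sumr -sumrB; apply: eq_bigr => i _; rewrite mulrBl.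
have Dle : 0 <= D <= \sum_(i <- s) (b i ord0 - m) * pbar i ord0.
  by rewrite sum_perm gapE pbar1 mulr1 -dotE subr_ge0 beta_lt lerD2l lerN2.
have lb p : dot b p <= beta -> simplex p ->
    2 * greedy m l D <= divergence (@phi_variation R) pbar p.
  move=> bp pS; have [p_ge0 p1] := pS.
  rewrite divergence_variation // sum_norm_simplex // ler_pM2l //.
  have [|||||lam lam0 ->] := @greedy_dual _ m l D 0 srt.
  - by rewrite lE all_map; apply/allP => i _ /=.
  - by rewrite lE all_map; apply/allP => i _ /=.
  - by rewrite lE big_map.
  - by [].
  - by apply/allP => x _; rewrite mul0r ler01.
  rewrite lE big_map /= sum_perm.
  apply: (@dual_bound _ _ (fun i => b i ord0)) => //.
    move=> i; rewrite le_max lexx ge_max pbar_ge0 gerBl p_ge0 //.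
  (* Both vectors have mass 1, so [m] drops out and feasibility gives [D] as a lower bound. Passing
     to positive parts only increases the sum, because all gaps are nonnegative. *)
  apply: le_trans (_ : \sum_i (b i ord0 - m) * (pbar i ord0 - p i ord0) <= _).
    rewrite gapE sumrB pbar1 p1 subrr mulr0 subr0 /D lerBlDl.
    apply: le_trans (lerD bp (lexx _)); rewrite !dotE -big_split /=.
    by apply: ler_sum => i _; rewrite mulrBr subrKC.
  apply: ler_sum => i _; apply: ler_wpM2l; first by rewrite subr_ge0 bj.
  by rewrite le_max lexx orbT.
have us : uniq s by rewrite (perm_uniq ps) index_enum_uniq.
have [x [xp _ sx bx]] := @greedy_primal _ _ (fun i => b i ord0)
  (fun i => pbar i ord0) m s D us pbar0 bj Dle.
move: sx bx; rewrite -lE !sum_perm => sx bx.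
pose X := \sum_i x i.
have X0 : 0 <= X by apply: sumr_ge0 => i _; case/andP: (xp i).
have sumj (F : 'I_n.+1 -> R) : \sum_i F i * (i == j)%:R = F j.
  rewrite (bigD1 j) //= eqxx mulr1 big1 ?addr0 // => i /negPf ->.
  by rewrite mulr0.
(* All removed mass [X] goes to an index [j] of least [b]. *)
pose p : 'cV[R]_n.+1 := \col_i (pbar i ord0 - x i + X * (i == j)%:R).
have pS : simplex p.
  split=> [i|].
    by rewrite mxE addr_ge0 ?mulr_ge0 // subr_ge0; case/andP: (xp i).
  under eq_bigr do rewrite mxE.
  by rewrite big_split /= sumrB pbar1 sumj subrK.
have bp : dot b p <= beta.
  rewrite dotE; under eq_bigr do rewrite mxE mulrDr mulrBr mulrA.
  rewrite big_split /= sumrB (sumj (fun i => b i ord0 * X)) -dotE -/m.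
  by move: bx; rewrite gapE -/X /D; lra.
split; last by move=> _ [q [bq qS] <-]; apply: lb.
exists p => //; apply: le_anti; rewrite lb // andbT.
rewrite divergence_variation // -sx -/X.
(* The triangle inequality suffices: removal and reinsertion each cost [X], which meets the lower
   bound. *)
apply: le_trans (_ : \sum_i (x i + X * (i == j)%:R) <= _); last first.
  by rewrite big_split /= sumj -/X; lra.
apply: ler_sum => i _; rewrite mxE addrAC addrAC addrC addrA addKr.
apply: le_trans (ler_normD _ _) _; rewrite normrN lerD // ger0_norm //.
  by case/andP: (xp i).
by rewrite mulr_ge0 //; case: (i == j).
Qed.

End Projection.

(** * Segments and sorted runs *)

Section Segments.
Local Open Scope nat_scope.
Context {T : Type}.
Implicit Types (f g : nat -> T) (s : seq T) (r : rel T).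

Definition seg f lo hi : seq T := [seq f i | i <- index_iota lo hi].

Lemma size_seg f lo hi : size (seg f lo hi) = hi - lo.
Proof. by rewrite size_map size_iota. Qed.

Lemma seg_nil f lo hi : hi <= lo -> seg f lo hi = [::].
Proof. by rewrite /seg /index_iota => /eqP ->. Qed.

Lemma seg_cons f lo hi : lo < hi -> seg f lo hi = f lo :: seg f lo.+1 hi.
Proof. by move=> h; rewrite /seg /index_iota -(subnSK h). Qed.

Lemma eq_seg f g lo hi : (forall i, lo <= i < hi -> f i = g i) ->
  seg f lo hi = seg g lo hi.
Proof.
rewrite /seg /index_iota => fg.
have [h|h] := leqP hi lo; first by rewrite (eqP h).
move: fg; rewrite -{1}(subnKC (ltnW h)).
move: (hi - lo) => d {h}; elim: d lo => //= d IH lo fg.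
congr cons; first by apply: fg; lia.
by apply: IH => i hi'; apply: fg; lia.
Qed.

Lemma seg_set f g k : (forall i, i < k -> g i = f i) ->
  seg g 0 k.+1 = rcons (seg f 0 k) (g k).
Proof.
move=> fg; rewrite /seg /index_iota !subn0 -addn1 iotaD map_cat cats1 add0n.
congr rcons; have := @eq_seg g f 0 k; rewrite /seg /index_iota subn0; apply=> i.
exact: fg.
Qed.

Lemma seg_cat f lo mid hi : (lo <= mid <= hi) ->
  seg f lo hi = seg f lo mid ++ seg f mid hi.
Proof.
move=> /andP[h1 h2]; rewrite /seg /index_iota -map_cat.
by rewrite -{2}(subnKC h1) -iotaD; congr (map _ (iota _ _)); lia.
Qed.

Lemma take_seg f lo hi w : lo <= hi ->
  take w (seg f lo hi) = seg f lo (minn (lo + w) hi).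
Proof.
move=> le; rewrite /seg /index_iota -map_take take_iota.
by congr (map _ (iota _ _)); lia.
Qed.

Lemma drop_seg f lo hi w : drop w (seg f lo hi) = seg f (minn (lo + w) hi) hi.
Proof.
rewrite /seg /index_iota -map_drop drop_iota.
have [h|h] := leqP (lo + w) hi; first by congr (map _ (iota _ _)); lia.
by rewrite subnn (_ : hi - lo - w = 0) //; lia.
Qed.

(** Blocks start at the multiples of [w]; the last one may be shorter, and those past the end are
    empty, hence sorted. *)
Definition runs_sorted r w s : Prop :=
  forall q, sorted r (take w (drop (q * w) s)).

Lemma runs_sorted1 r s : runs_sorted r 1 s.
Proof. by move=> q; case: (drop _ _) => [|x [|y l]]. Qed.

Lemma runs_sorted_whole r w s : size s <= w ->
  runs_sorted r w s <-> sorted r s.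
Proof.
move=> sw; split=> [/(_ 0)|srt q]; first by rewrite mul0n drop0 take_oversize.
case: q => [|q]; first by rewrite mul0n drop0 take_oversize.
by rewrite drop_oversize // mulSn (leq_trans sw) // leq_addr.
Qed.

Lemma runs_sorted_head r w s : runs_sorted r w s -> sorted r (take w s).
Proof. by move=> /(_ 0); rewrite mul0n drop0. Qed.

Lemma runs_sorted_drop r w s : runs_sorted r w s -> runs_sorted r w (drop w s).
Proof. by move=> h q; rewrite drop_drop addnC -mulSn. Qed.

Lemma runs_sorted_cat r w s1 s2 : size s1 = w -> sorted r s1 ->
  runs_sorted r w s2 -> runs_sorted r w (s1 ++ s2).
Proof.
move=> sz srt h [|q]; first by rewrite mul0n drop0 take_size_cat.
by rewrite mulSn addnC -drop_drop drop_size_cat.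
Qed.

Lemma merge_consl r x s1 s2 :
  (if s2 is y :: _ then r x y else true) ->
  merge r (x :: s1) s2 = x :: merge r s1 s2.
Proof. by case: s2 => [|y s2] /= => [_|->//]; case: s1. Qed.

Lemma merge_consr r y s1 s2 :
  (if s1 is x :: _ then ~~ r x y else true) ->
  merge r s1 (y :: s2) = y :: merge r s1 s2.
Proof. by case: s1 => [|x s1] //= /negPf ->. Qed.

End Segments.

(** * Timed execution *)

Section Runs.
Context {R : realType}.
Local Open Scope nat_scope.
Implicit Types (c : prog) (s : state R) (Q : state R -> Prop).

(** The time [n] is only an upper bound, so that branches of different cost can share one
    estimate. *)
Definition runs c s n Q : Prop :=
  exists t s', [/\ exec c s t s', t <= n & Q s'].

Lemma runs_impl c s n n' Q Q' : n <= n' -> (forall s', Q s' -> Q' s') ->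
  runs c s n Q -> runs c s n' Q'.
Proof.
move=> nn QQ [t [s' [e tn q]]]; exists t, s'; split=> //; last exact: QQ.
exact: leq_trans tn nn.
Qed.

Lemma runs_seq c1 c2 s n1 n2 Q :
  runs c1 s n1 (fun s' => runs c2 s' n2 Q) -> runs (Seq c1 c2) s (n1 + n2) Q.
Proof.
move=> [t1 [s1 [e1 l1 [t2 [s2 [e2 l2 q]]]]]].
by exists (t1 + t2), s2; split=> //; [apply: ExecSeq e1 e2|apply: leq_add].
Qed.

(* [I n s] reads: the loop can still be run from [s] in [n] steps, not counting
   its last test. *)
Lemma runs_while (I : nat -> state R -> Prop) b c Q n s :
  (forall n s, I n s -> eval_test s b ->
    exists t, runs c s t (fun s' => exists2 n', I n' s' & t + n' < n)) ->
  (forall n s, I n s -> ~~ eval_test s b -> Q s) ->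
  I n s -> runs (While b c) s n.+1 Q.
Proof.
move=> step final; have [m] := ubnP n; elim: m n s => // m IH n s nm Is.
case: (boolP (eval_test s b)) => bs; last first.
  exists 1, s; split=> //; last exact: final Is bs.
  by apply: ExecWhileFalse; apply: negbTE.
(* The strict inequality [ln] leaves one unit to pay for the loop test. *)
have [t [t1 [s1 [e1 l1 [n' I1 ln]]]]] := step _ _ Is bs.
have [|t2 [s2 [e2 l2 q]]] := IH n' s1 _ I1; first by lia.
exists (t1 + t2).+1, s2; split=> //; first exact: ExecWhileTrue bs e1 e2.
by lia.
Qed.

(** Weakest precondition for loop-free code; loops go through [runs_while]. A division by zero has
    no postcondition. *)
Fixpoint wp c Q s : Prop :=
  match c with
  | Skip => Q s
  | RegConst x k => Q (set_reg s x k)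
  | RegAdd x y z => Q (set_reg s x (regs s y + regs s z))
  | RegSub x y z => Q (set_reg s x (regs s y - regs s z))
  | RealConst l k => Q (set_cell s l k%:R%R)
  | RealCopy l m => Q (set_cell s l (Defs.get s m))
  | RealOp o l m n =>
      if eval_op o (Defs.get s m) (Defs.get s n) is Some r then Q (set_cell s l r)
      else False
  | Seq c1 c2 => wp c1 (wp c2 Q) s
  | If b c1 c2 => if eval_test s b then wp c1 Q s else wp c2 Q s
  | While _ _ => False
  end.

Fixpoint cost c : nat :=
  match c with
  | Skip => 0
  | Seq c1 c2 => cost c1 + cost c2
  | If _ c1 c2 => (maxn (cost c1) (cost c2)).+1
  | _ => 1
  end.

Lemma wp_runs c s Q : wp c Q s -> runs c s (cost c) Q.
Proof.
elim: c s Q => //=; try by move=> *; eexists _, _; split; last eassumption;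
  [constructor|].
- move=> o l m n s Q; case E: eval_op => [r|//] q.
  by eexists _, _; split; last eassumption; [apply: ExecRealOp E|].
- move=> c1 IH1 c2 IH2 s Q /IH1 h; apply: runs_seq; move: h.
  by apply: runs_impl => // s'; apply: IH2.
- move=> b c1 IH1 c2 IH2 s Q h.
  suff [t [s' [e l q]]] : runs (if eval_test s b then c1 else c2) s
      (maxn (cost c1) (cost c2)) Q by exists t.+1, s'; split=> //; constructor.
  move: h; case: eval_test => [/IH1|/IH2]; apply: runs_impl => //.
    exact: leq_maxl.
  exact: leq_maxr.
Qed.

End Runs.

(** * Merge sort *)

(* Arrays 0 and 1 hold the records (weight, key), arrays 4 and 5 receive the
   merged runs.  In the sweep, array 6 holds the part of D still to be covered
   and array 7 the least key; scalars sit at the index in [rzero]. *)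
Local Notation rn := 0%N (only parsing).
Local Notation rzero := 1%N (only parsing).
Local Notation rone := 2%N (only parsing).
Local Notation rw := 3%N (only parsing).
Local Notation ri := 4%N (only parsing).
Local Notation rmid := 5%N (only parsing).
Local Notation rj := 6%N (only parsing).
Local Notation rhi := 7%N (only parsing).
Local Notation rk := 8%N (only parsing).
Local Notation rtmp := 9%N (only parsing).
Local Notation "c1 ;; c2" := (Seq c1 c2)
  (at level 55, right associativity, only parsing).

Definition emit (x : reg) : prog :=
  RealCopy (5%N, rk) (1%N, x) ;; RealCopy (4%N, rk) (0%N, x) ;;
  RegAdd x x rone.

Arguments emit : simpl never.

Definition merge_step : prog :=
  If (RegLt ri rmid)
    (If (RegLt rj rhi)
      (If (RealLe (1%N, rj) (1%N, ri)) (emit ri) (emit rj))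
      (emit ri))
    (emit rj) ;;
  RegAdd rk rk rone.

Definition merge_loop : prog := While (RegLt rk rhi) merge_step.

(** With truncated subtraction, [x - (x - n)] is the minimum of [x] and [n]. *)
Definition clip (x : reg) : prog := RegSub rtmp x rn ;; RegSub x x rtmp.

Definition next_pair : prog :=
  RegAdd rmid ri rw ;; clip rmid ;; RegAdd rj rmid rzero ;;
  RegAdd rhi rmid rw ;; clip rhi.

Definition merge_pair : prog :=
  next_pair ;; merge_loop ;; RegAdd ri rhi rzero.

Definition for_loop (c : prog) : prog :=
  RegConst rk 0 ;; While (RegLt rk rn) (c ;; RegAdd rk rk rone).

Definition copy_back : prog :=
  RealCopy (1%N, rk) (5%N, rk) ;; RealCopy (0%N, rk) (4%N, rk).

(** The output index [rk] is not reset between pairs, so the merged runs are laid out consecutively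
    in arrays 4 and 5. *)
Definition merge_pass : prog :=
  RegConst ri 0 ;; RegConst rk 0 ;; While (RegLt ri rn) merge_pair ;;
  for_loop copy_back ;; RegAdd rw rw rw.

Definition merge_sort : prog :=
  RegConst rone 1 ;; RegConst rw 1 ;; While (RegLt rw rn) merge_pass.

(** * Correctness and step count of the merge sort *)

Section Verification.
Context {R : realType}.
Implicit Types (s : state R).

Definition env n (beta : R) s : Prop :=
  [/\ regs s rn = n, regs s rzero = 0%N, regs s rone = 1%N
    & cells s 2 0 = beta].

Definition rec (aK aW : nat) s (i : nat) : R * R := (cells s aK i, cells s aW i).

(** [G] is the final output prefix, constant throughout the loop: what has been emitted, followed by
    the merge of what remains. The index equation says that as many records were emitted as were
    read from the two runs. *)
Definition merge_inv n beta w mid hi (f : nat -> R * R) G s : Prop :=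
  [/\ env n beta s,
      [/\ regs s rw = w, regs s rmid = mid, regs s rhi = hi & rec 1 0 s = f],
      [/\ (regs s ri <= mid)%N, (regs s rj <= hi)%N &
          (regs s ri + regs s rj = regs s rk + mid)%N]
    & seg (rec 5 4 s) 0 (regs s rk) ++
      merge key_ge (seg f (regs s ri) mid) (seg f (regs s rj) hi) = G].

(** Phrased with the increment of [rk] as continuation, the shape of each leaf of [wp merge_step].
    The condition on the keys also covers an exhausted right run. *)
Lemma merge_inv_left n beta w mid hi f G s :
  merge_inv n beta w mid hi f G s -> (regs s ri < mid)%N ->
  (if (regs s rj < hi)%N then key_ge (f (regs s ri)) (f (regs s rj))
   else true) ->
  wp (emit ri) (wp (RegAdd rk rk rone) (fun s' =>
    merge_inv n beta w mid hi f G s' /\ regs s' rk = (regs s rk).+1)) s.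
Proof.
rewrite /merge_inv /env => -[[n0 z o be] [ww mm hh ff] [im jh ij] GE] lt ge.
rewrite /emit /=.
rewrite /Defs.get /set_cell /set_reg /= !o !addn1; split=> //.
split=> //.
- by split=> //; lia.
- move: GE; rewrite (@seg_set _ (rec 5 4 s)); last first.
    by move=> i ik; rewrite /rec /= !ltn_eqF.
  rewrite (seg_cons f lt) merge_consl; last first.
    by move: ge; case: ltnP => h; [rewrite (seg_cons f h)|rewrite seg_nil].
  by rewrite cat_rcons /rec /= !eqxx -ff.
Qed.

Lemma merge_inv_right n beta w mid hi f G s :
  merge_inv n beta w mid hi f G s -> (regs s rj < hi)%N ->
  (if (regs s ri < mid)%N then ~~ key_ge (f (regs s ri)) (f (regs s rj))
   else true) ->
  wp (emit rj) (wp (RegAdd rk rk rone) (fun s' =>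
    merge_inv n beta w mid hi f G s' /\ regs s' rk = (regs s rk).+1)) s.
Proof.
rewrite /merge_inv /env => -[[n0 z o be] [ww mm hh ff] [im jh ij] GE] lt ge.
rewrite /emit /=.
rewrite /Defs.get /set_cell /set_reg /= !o !addn1; split=> //.
split=> //.
- by split=> //; lia.
- move: GE; rewrite (@seg_set _ (rec 5 4 s)); last first.
    by move=> i ik; rewrite /rec /= !ltn_eqF.
  rewrite (seg_cons f lt) merge_consr; last first.
    by move: ge; case: ltnP => h; [rewrite (seg_cons f h)|rewrite seg_nil].
  by rewrite cat_rcons /rec /= !eqxx -ff.
Qed.

Lemma merge_step_wp n beta w mid hi f G s :
  merge_inv n beta w mid hi f G s -> (regs s rk < hi)%N ->
  wp merge_step (fun s' =>
    merge_inv n beta w mid hi f G s' /\ regs s' rk = (regs s rk).+1) s.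
Proof.
move=> inv kh; have [_ [_ mm hh ff] [im jh ij] _] := inv.
rewrite /merge_step /= mm hh; case: ltnP => ilt; last first.
  (* With the left run exhausted, the index equation gives [rj = rk], so the right run is not
     empty. *)
  by apply: (merge_inv_right inv); [lia|rewrite ltnNge ilt].
case: ltnP => jlt; last by apply: (merge_inv_left inv); rewrite // ltnNge jlt.
rewrite /Defs.get /=; case: ifP => le.
  by apply: (merge_inv_left inv); rewrite // jlt -ff.
by apply: (merge_inv_right inv); rewrite // ilt -ff /key_ge le.
Qed.

Lemma merge_loop_runs n beta w mid hi f G s :
  merge_inv n beta w mid hi f G s ->
  runs merge_loop s ((hi - regs s rk) * 9).+1 (fun s' =>
    [/\ env n beta s', regs s' rw = w, rec 1 0 s' = f &
    [/\ regs s' rhi = hi, regs s' rk = hi & seg (rec 5 4 s') 0 hi = G]]).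
Proof.
move=> inv; apply: (@runs_while _ (fun m s' =>
  merge_inv n beta w mid hi f G s' /\ m = ((hi - regs s' rk) * 9)%N)) => //.
- move=> m {inv}s [inv ->] /=; have [_ [_ _ -> _] _ _] := inv => kh.
  exists (cost merge_step); apply: runs_impl (wp_runs (merge_step_wp inv kh)) => //.
  move=> s' [inv' kE]; exists ((hi - regs s' rk) * 9)%N => //.
  by rewrite kE /=; lia.
- move=> m {inv}s [[e [ww mm hh ff] [im jh ij] GE] _] /=.
  rewrite hh -leqNgt => hk.
  have [iE jE kE] : [/\ regs s ri = mid, regs s rj = hi & regs s rk = hi].
    by split; lia.
  split=> //; split=> //.
  by move: GE; rewrite iE jE kE !(@seg_nil _ _ _ _ (leqnn _)) cats0.
Qed.

(** Each round pays for [c], the increment and the test; the final 2 is the initialisation and the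
    last test. *)
Lemma for_loop_runs n (I : nat -> state R -> Prop) c (Q : state R -> Prop) s :
  (forall k s, I k s -> regs s rn = n /\ regs s rk = k) ->
  (forall k s, (k < n)%N -> I k s -> wp (c ;; RegAdd rk rk rone) (I k.+1) s) ->
  (forall s, I n s -> Q s) -> I 0%N (set_reg s rk 0) ->
  runs (for_loop c) s (n * (cost c + 2) + 2)%N Q.
Proof.
move=> Ireg step final I0; rewrite addn2 -add1n; apply: runs_seq.
apply: runs_impl (wp_runs (_ : wp (RegConst rk 0) (I 0%N) s)) => // {I0}s0 I0.
apply: (@runs_while _ (fun m s' => (regs s' rk <= n)%N /\ I (regs s' rk) s' /\
    m = ((n - regs s' rk) * (cost c + 2))%N)).
- move=> m s' [kn [Ik ->]]; have [nE _] := Ireg _ _ Ik; rewrite /eval_test nE => lt.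
  exists (cost c + 1)%N; apply: runs_impl (wp_runs (step _ _ lt Ik)) => // s2 Ik2.
  have [n2E kE] := Ireg _ _ Ik2; exists ((n - regs s2 rk) * (cost c + 2))%N.
    by rewrite kE.
  by rewrite kE; nia.
- move=> m s' [kn [Ik _]]; have [nE _] := Ireg _ _ Ik; rewrite /eval_test nE.
  rewrite -leqNgt => nk; apply: final; suff <- : regs s' rk = n by [].
  by lia.
- by have [_ kE] := Ireg _ _ I0; rewrite kE subn0.
Qed.

Lemma next_pair_wp n beta w f s :
  env n beta s -> regs s rw = w -> rec 1 0 s = f ->
  wp next_pair (fun s' =>
    [/\ env n beta s', regs s' rw = w, rec 1 0 s' = f, rec 5 4 s' = rec 5 4 s &
    [/\ regs s' ri = regs s ri, regs s' rk = regs s rk,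
        regs s' rmid = minn (regs s ri + w) n, regs s' rj = regs s' rmid &
        regs s' rhi = minn (minn (regs s ri + w) n + w) n]]) s.
Proof.
move=> [n0 z o be] ww ff.
rewrite /= /env /set_reg /= n0 z o ww be addn0; split=> //.
have mE a : (a - (a - n) = minn a n)%N by lia.
by rewrite !mE.
Qed.

(** The last clause speaks of all admissible continuations [l] of the output. It thereby encodes the
    block alignment of the prefix without requiring its length to be a multiple of [w + w], which
    may fail after the last pair. *)
Definition pass_inv n beta w f s : Prop :=
  [/\ env n beta s, regs s rw = w, rec 1 0 s = f &
  [/\ (regs s ri <= n)%N, regs s rk = regs s ri,
      runs_sorted key_ge w (seg f (regs s ri) n),
      perm_eq (seg (rec 5 4 s) 0 (regs s ri)) (seg f 0 (regs s ri)) &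
      forall l, size l = (n - regs s ri)%N -> runs_sorted key_ge (w + w) l ->
        runs_sorted key_ge (w + w) (seg (rec 5 4 s) 0 (regs s ri) ++ l)]].

Lemma merge_pair_runs n beta w f s :
  (0 < w)%N -> pass_inv n beta w f s -> (regs s ri < n)%N ->
  exists t, runs merge_pair s t (fun s' => pass_inv n beta w f s' /\
    (t + (n - regs s' ri) * 20 < (n - regs s ri) * 20)%N).
Proof.
move=> w0 [e ww ff [le kE srt pe pre]] lt.
set lo := regs s ri in lt le kE srt pe pre *.
set mid := minn (lo + w) n; set hi := minn (mid + w) n.
(* With [cost next_pair] equal to 7 this is [9 * (hi - lo) + 9]; as [lo < hi], a budget of 20 per
   record covers it and the loop test. *)
exists (cost next_pair + (((hi - lo) * 9).+1 + 1))%N.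
apply: runs_seq; apply: runs_impl (wp_runs (next_pair_wp e ww ff)) => // s1.
rewrite -/lo -/mid -/hi.
move=> [e1 ww1 ff1 gg1 [iE1 kE1 mE1 jE1 hE1]].
pose G := seg (rec 5 4 s) 0 lo ++ merge key_ge (seg f lo mid) (seg f mid hi).
have inv : merge_inv n beta w mid hi f G s1.
  split=> //; rewrite ?iE1 ?kE1 ?kE ?jE1 ?mE1 ?gg1 //.
  by split=> //; rewrite -/lo /hi /mid; lia.
apply: runs_seq; apply: runs_impl (merge_loop_runs inv) => [|s2].
  by rewrite kE1 kE.
move=> [e2 ww2 ff2 [hE2 kE2 GE]].
apply: wp_runs.
have [n2 z2 o2 b2] := e2.
rewrite /= /pass_inv /env /set_reg /= hE2 z2 addn0.
have lohi : (lo < hi <= n)%N by rewrite /hi /mid; lia.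
split; last by lia.
split=> //.
have szL : size (seg (rec 5 4 s) 0 lo) = lo by rewrite size_seg subn0.
have midE : seg f lo mid = take w (seg f lo n) by rewrite take_seg.
have midn : (lo <= mid <= n)%N by rewrite /mid; lia.
have hiE : seg f mid hi = take w (drop w (seg f lo n)).
  by rewrite drop_seg take_seg //; case/andP: midn.
have srt2 : runs_sorted key_ge w (seg f mid n).
  by rewrite /mid -drop_seg; apply: runs_sorted_drop.
have Msrt : sorted key_ge (merge key_ge (seg f lo mid) (seg f mid hi)).
  apply: merge_sorted; first exact: key_ge_total.
  - by rewrite midE; apply: runs_sorted_head.
  - rewrite hiE drop_seg; exact: runs_sorted_head.
have Msz : size (merge key_ge (seg f lo mid) (seg f mid hi)) = (hi - lo)%N.
  by rewrite size_merge size_cat !size_seg /hi /mid; lia.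
split=> //; first by case/andP: lohi.
- by rewrite /hi -drop_seg; apply: runs_sorted_drop.
- rewrite -[rec 5 4 _]/(rec 5 4 s2) GE /G (@seg_cat _ f 0 lo hi); last by lia.
  rewrite perm_cat // perm_merge -seg_cat //; rewrite /hi /mid; lia.
move=> l szl lsrt; rewrite -[rec 5 4 _]/(rec 5 4 s2) GE /G -catA.
apply: pre; first by rewrite size_cat Msz szl; lia.
(* Either this is the last pair, whose merged run may be short, or the merged run is a full block of
   length [w + w]. *)
have [le2|gt2] := leqP n (lo + (w + w)).
  have -> : l = [::] by apply: size0nil; rewrite szl /hi /mid; lia.
  by rewrite cats0 runs_sorted_whole // Msz /hi /mid; lia.
by apply: runs_sorted_cat => //; rewrite Msz /hi /mid; lia.
Qed.

Definition sort_inv n beta w l s : Prop :=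
  [/\ env n beta s, regs s rw = w, (0 < w)%N,
      runs_sorted key_ge w (seg (rec 1 0 s) 0 n) &
      perm_eq (seg (rec 1 0 s) 0 n) l].

Lemma copy_back_runs n beta w g s :
  env n beta s -> regs s rw = w -> rec 5 4 s = g ->
  runs (for_loop copy_back) s (n * 4 + 2)%N (fun s' =>
    [/\ env n beta s', regs s' rw = w & seg (rec 1 0 s') 0 n = seg g 0 n]).
Proof.
move=> e ww gg.
apply: (@for_loop_runs n (fun k s' => [/\ env n beta s', regs s' rw = w,
  regs s' rk = k, rec 5 4 s' = g & seg (rec 1 0 s') 0 k = seg g 0 k])).
- by move=> k {e ww gg}s [[]].
- move=> k {e ww gg}s kn [[n0 z o be] ww kk gg E].
  rewrite /= /env /Defs.get /set_cell /set_reg /= kk o addn1; split=> //.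
  rewrite (@seg_set _ (rec 1 0 s)); last first.
    by move=> i ik; rewrite /rec /= !ltn_eqF.
  rewrite (@seg_set _ g g) // E; congr rcons.
  by rewrite /rec /= !eqxx -gg.
- by move=> {e ww gg}s [].
- by have [] := e; split=> //; rewrite seg_nil.
Qed.

Lemma merge_pass_runs n beta w l s :
  sort_inv n beta w l s ->
  runs merge_pass s (n * 24 + 6)%N (sort_inv n beta (w + w) l).
Proof.
move=> [e ww w0 srt pe].
have -> : (n * 24 + 6 = 1 + (1 + ((n * 20).+1 + ((n * 4 + 2) + 1))))%N by lia.
set f := rec 1 0 s.
do 2 (apply: runs_seq; apply: wp_runs; rewrite /=).
set s1 := (X in runs _ X).
have inv1 : pass_inv n beta w f s1 by have [] := e; split=> //; split=> //; lia.
have -> : (n * 20 = (n - regs s1 ri) * 20)%N by rewrite subn0.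
apply: runs_seq; apply: (@runs_while _ (fun m s' => pass_inv n beta w f s' /\
  m = (n - regs s' ri) * 20)%N) => //.
  move=> m s2 [inv ->] /=; have [[-> _ _ _] _ _ _] := inv => lt.
  have [t h] := merge_pair_runs w0 inv lt; exists t.
  by apply: runs_impl h => // s3 [inv3 ?]; exists ((n - regs s3 ri) * 20)%N.
move=> m s2 [[e2 ww2 ff2 [le2 kE2 srt2 pe2 pre2]] _] /= lt2.
have iE : regs s2 ri = n.
  by move: lt2; have [-> _ _ _] := e2; rewrite -leqNgt; lia.
apply: runs_seq; apply: runs_impl (copy_back_runs e2 ww2 erefl) => // s3.
move=> [[n3 z3 o3 b3] ww3 E3]; apply: wp_runs.
rewrite /= /sort_inv /env /set_reg /= ww3; split=> //; first by lia.
- rewrite -[rec 1 0 _]/(rec 1 0 s3) E3.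
  (* At the end of the pass only the empty continuation is left. *)
  have := pre2 [::]; rewrite iE subnn cats0 => /(_ erefl); apply.
  exact/runs_sorted_whole.
- rewrite -[rec 1 0 _]/(rec 1 0 s3) E3; apply: perm_trans pe.
  by move: pe2; rewrite iE.
Qed.

(** After [e] passes the runs have width [2 ^ e], so at most [up_log 2 n] passes occur, each costing
    [n * 24 + 6] plus a test. *)
Lemma merge_sort_runs n beta l s :
  regs s rn = n -> regs s rzero = 0%N -> cells s 2 0 = beta ->
  seg (rec 1 0 s) 0 n = l ->
  runs merge_sort s (up_log 2 n * (n * 24 + 7) + 3)%N (fun s' =>
    [/\ env n beta s', sorted key_ge (seg (rec 1 0 s') 0 n) &
        perm_eq (seg (rec 1 0 s') 0 n) l]).
Proof.
move=> n0 z be lE.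
have -> : (up_log 2 n * (n * 24 + 7) + 3 =
  1 + (1 + (up_log 2 n * (n * 24 + 7)).+1))%N.
  by lia.
do 2 (apply: runs_seq; apply: wp_runs; rewrite /=).
set s1 := (X in runs _ X).
apply: (@runs_while _ (fun m s' => exists e, sort_inv n beta (2 ^ e) l s' /\
  m = ((up_log 2 n - e) * (n * 24 + 7))%N)).
- move=> m s2 [e [inv ->]] /=; have [[-> _ _ _] -> _ _ _] := inv => lt.
  exists (n * 24 + 6)%N; apply: runs_impl (merge_pass_runs inv) => // s3 inv3.
  exists ((up_log 2 n - e.+1) * (n * 24 + 7))%N.
    by exists e.+1; rewrite expnS mul2n -addnn.
  have lt2 : (e < up_log 2 n)%N.
    by rewrite ltnNge; apply/negP => /(leq_pexp2l (isT : (0 < 2)%N)) le;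
      have := up_logP n (isT : (1 < 2)%N); lia.
  by nia.
- move=> m s2 [e [[e2 ww _ srt pe] _]] /=; have [-> _ _ _] := e2.
  rewrite ww -leqNgt => le; split=> //.
  by move: srt; rewrite runs_sorted_whole // size_seg subn0.
- exists 0%N; rewrite subn0; split=> //; split=> //.
    exact: runs_sorted1.
  by rewrite -[rec 1 0 _]/(rec 1 0 s) lE.
Qed.

End Verification.

(** * The sweep and the whole program *)

Definition sum_step : prog :=
  RealOp Mul (8%N, rzero) (1%N, rk) (0%N, rk) ;;
  RealOp Add (6%N, rzero) (6%N, rzero) (8%N, rzero).

(** Zeroing the remaining [D] after the fractional record replaces an early exit. The division is
    safe: it is reached only when the gap is positive. *)
Definition sweep_step : prog :=
  If (RealLe (1%N, rk) (7%N, rzero)) Skip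
    (RealOp Defs.Sub (8%N, rzero) (1%N, rk) (7%N, rzero) ;;
     RealOp Mul (9%N, rzero) (8%N, rzero) (0%N, rk) ;;
     If (RealLe (9%N, rzero) (6%N, rzero))
       (RealOp Add (3%N, rzero) (3%N, rzero) (0%N, rk) ;;
        RealOp Defs.Sub (6%N, rzero) (6%N, rzero) (9%N, rzero))
       (RealOp Div (6%N, rzero) (6%N, rzero) (8%N, rzero) ;;
        RealOp Add (3%N, rzero) (3%N, rzero) (6%N, rzero) ;;
        RealConst (6%N, rzero) 0)).

(** After the descending sort the least key is the last one, at index [n - 1] for [n] the content of
    [rn]. The closing addition doubles the knapsack value. *)
Definition projection_prog : prog :=
  merge_sort ;;
  (RegSub ri rn rone ;; RealCopy (7%N, rzero) (1%N, ri) ;;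
   RealConst (6%N, rzero) 0) ;;
  for_loop sum_step ;;
  (RealOp Defs.Sub (6%N, rzero) (6%N, rzero) (2%N, rzero) ;;
   RealConst (3%N, rzero) 0) ;;
  for_loop sweep_step ;;
  RealOp Add (3%N, rzero) (3%N, rzero) (3%N, rzero).

Section Verification.
Context {R : realType}.
Implicit Types (s : state R).

Lemma sum_runs n beta m f s :
  env n beta s -> cells s 7 0 = m -> rec 1 0 s = f -> cells s 6 0 = 0 ->
  runs (for_loop sum_step) s (n * 4 + 2)%N (fun s' =>
    [/\ env n beta s', cells s' 7 0 = m, rec 1 0 s' = f &
        cells s' 6 0 = \sum_(x <- seg f 0 n) x.1 * x.2]).
Proof.
move=> e mm ff d0.
apply: (@for_loop_runs _ n (fun k s' => [/\ env n beta s', cells s' 7 0 = m,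
  rec 1 0 s' = f, regs s' rk = k &
  cells s' 6 0 = \sum_(x <- seg f 0 k) x.1 * x.2])).
- by move=> k {e mm ff d0}s [[]].
- move=> k {e mm ff d0}s kn [[n0 z o be] mm ff kk E].
  rewrite /= /env /Defs.get /set_cell /set_reg /= z kk o addn1; split=> //.
  rewrite (@seg_set _ f f) // -cats1 big_cat big_seq1 E -ff /rec /=.
  by [].
- by move=> {e mm ff d0}s [].
- by have [] := e; split=> //; rewrite seg_nil // big_nil.
Qed.

Lemma sweep_runs n beta m f D s :
  env n beta s -> cells s 7 0 = m -> rec 1 0 s = f -> cells s 6 0 = D ->
  cells s 3 0 = 0 -> all (fun x => 0 < x.2) (seg f 0 n) ->
  runs (for_loop sweep_step) s (n * 9 + 2)%N (fun s' =>
    env n beta s' /\ cells s' 3 0 = greedy m (seg f 0 n) D).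
Proof.
move=> e mm ff dd v0 pos.
(* Invariant: the accumulated value plus the greedy value of the unread records is constant. *)
apply: (@for_loop_runs _ n (fun k s' => [/\ env n beta s', cells s' 7 0 = m,
  rec 1 0 s' = f, regs s' rk = k &
  (k <= n)%N /\ cells s' 3 0 + greedy m (seg f k n) (cells s' 6 0) =
    greedy m (seg f 0 n) D])).
- by move=> k {e mm ff dd v0}s [[]].
- move=> k {e mm ff dd v0}s kn [[n0 z o be] mm ff kk [_ E]].
  have fk : f k = (cells s 1 k, cells s 0 k) by rewrite -ff.
  move: E; rewrite (seg_cons f kn) fk /= /env /Defs.get /= z kk mm.
  case: (leP (cells s 1 k) m) => [_|mk] E; first by rewrite /set_reg /= ?kk ?o addn1.
  rewrite /set_cell /= ?z ?kk ?mm /=; move: E; case: leP => _ E.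
    by rewrite /set_reg /= ?z ?kk ?o addn1; split=> //; split=> //; rewrite -addrA.
  rewrite gt_eqF ?subr_gt0 //= /set_reg /= ?z ?kk ?o addn1; split=> //; split=> //.
  rewrite greedy_0 ?addr0 //; move: pos.
  by rewrite (@seg_cat _ f 0 k.+1 n) ?all_cat => [/andP[]|].
- by move=> {e mm ff dd v0}s [e _ _ _ [_]]; rewrite seg_nil //= addr0.
- by have [] := e; split=> //; split=> //=; rewrite v0 dd add0r.
Qed.

Lemma projection_prog_runs n (W K : nat -> R) beta s :
  let l0 := seg (fun i => (K i, W i)) 0 n.+1 in
  regs s rn = n.+1 -> regs s rzero = 0%N -> cells s 0 = W -> cells s 1 = K ->
  cells s 2 0 = beta -> all (fun x => 0 < x.2) l0 ->
  runs projection_prog s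
    (up_log 2 n.+1 * (n.+1 * 24 + 7) + n.+1 * 13 + 13)%N
    (fun s' => exists l m, [/\ sorted key_ge l, perm_eq l l0, m \in unzip1 l,
      all (fun x => m <= x.1) l &
      output s' = 2 * greedy m l (\sum_(x <- l0) x.1 * x.2 - beta)]).
Proof.
move=> l0 n0 z WE KE be pos.
have lE : seg (rec 1 0 s) 0 n.+1 = l0 by rewrite /rec WE KE.
have -> : (up_log 2 n.+1 * (n.+1 * 24 + 7) + n.+1 * 13 + 13 =
  (up_log 2 n.+1 * (n.+1 * 24 + 7) + 3) +
  (3 + ((n.+1 * 4 + 2) + (2 + ((n.+1 * 9 + 2) + 1)))))%N by lia.
apply: runs_seq; apply: runs_impl (merge_sort_runs n0 z be lE) => // s1.
move=> [[n1 z1 o1 b1] srt pe].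
set f := rec 1 0 s1 in srt pe; set l := seg f 0 n.+1 in srt pe.
have lR : l = rcons (seg f 0 n) (f n) by rewrite /l (@seg_set _ f f).
apply: runs_seq; apply: wp_runs; rewrite /=.
set s2 := (X in runs _ X).
have [e2 m2 f2 d2] : [/\ env n.+1 beta s2, cells s2 7 0 = (f n).1,
    rec 1 0 s2 = f & cells s2 6 0 = 0].
  rewrite /s2 /env /Defs.get /set_cell /set_reg /= n1 z1 o1 b1 subn1 /=.
  by split.
apply: runs_seq; apply: runs_impl (sum_runs e2 m2 f2 d2) => // s3.
move=> [[n3 z3 o3 b3] m3 f3 d3].
apply: runs_seq; apply: wp_runs; rewrite /=.
set s4 := (X in runs _ X).
have [e4 m4 f4 d4] : [/\ env n.+1 beta s4, cells s4 7 0 = (f n).1,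
    rec 1 0 s4 = f & cells s4 6 0 = \sum_(x <- l0) x.1 * x.2 - beta].
  rewrite /s4 /env /Defs.get /set_cell /set_reg /= n3 z3 o3 b3 d3; split=> //.
  (* The sum was computed over the sorted records; it is the same in input order. *)
  by congr (_ - _); apply: perm_big.
have v4 : cells s4 3 0 = 0 by rewrite /s4 /set_cell /= z3.
have pos4 : all (fun x => 0 < x.2) l by rewrite (perm_all _ pe).
apply: runs_seq; apply: runs_impl (sweep_runs e4 m4 f4 d4 v4 pos4) => // s5.
move=> [[n5 z5 o5 b5] v5]; apply: wp_runs.
rewrite /output /= /Defs.get /set_cell /= z5 v5 eqxx.
exists l, (f n).1; split=> //.
- by rewrite lR /unzip1 map_rcons mem_rcons mem_head.
(* Reversing the list puts its last record first in increasing order, which makes it minimal. *)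
- move: srt; rewrite lR -[sorted _ _]/(sorted (fun x y : R * R => y.1 <= x.1) _).
  rewrite -rev_sorted rev_rcons /= => srt.
  have tr : transitive (fun x y : R * R => x.1 <= y.1).
    by move=> x y t; apply: le_trans.
  rewrite all_rcons lexx /= -all_rev.
  exact: (order_path_min tr srt).
- by rewrite mulr_natl mulr2n.
Qed.

End Verification.

(** * Asymptotics of the step count, and conclusion *)

Lemma natn_up_log_bigO (R : realType) (a : nat) :
  (fun S : nat => (a * (S * (up_log 2 S).+1))%:R : R^o)
    =O_\oo (fun S : nat => S%:R * ln (S%:R : R) : R^o).
Proof.
apply/eqO_exP; have ln2 : 0 < ln (2 : R) by rewrite ln_gt0 // ltr1n.
(* The summand 1 keeps the constant positive when [a] is 0. *)
exists (a%:R * 3 / ln 2 + 1).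
  by rewrite ltr_wpDl // divr_ge0 ?mulr_ge0 // ltW.
near=> S.
have S2 : (2 <= S)%N by near: S; exists 2%N.
have S0 : (0 < S)%N by lia.
have lnS : ln (2 : R) <= ln S%:R by rewrite ler_ln ?posrE ?ltr0n // ler_nat.
have logS : ((up_log 2 S).-1)%:R * ln (2 : R) <= ln S%:R.
  rewrite mulr_natl -lnXn // ler_ln ?posrE ?exprn_gt0 ?ltr0n //.
  by rewrite -natrX ler_nat ltnW // up_log_gtn.
(* The predecessor of [up_log 2 S] is at most the binary logarithm of [S], and the remaining 2 is at
   most twice that logarithm for [S] at least 2. *)
have bound : ((up_log 2 S).+1)%:R <= 3 / ln 2 * ln (S%:R : R).
  rewrite mulrAC ler_pdivlMr //.
  have -> : (up_log 2 S).+1 = ((up_log 2 S).-1 + 2)%N.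
    by have := up_log_gt0 2 S; rewrite S2 /=; lia.
  by rewrite natrD mulrDl; lra.
rewrite ger0_norm // ger0_norm; last by rewrite mulr_ge0 // (le_trans _ lnS) // ltW.
apply: (@le_trans _ _ ((a%:R * 3 / ln 2) * (S%:R * ln (S%:R : R)))); last first.
  by rewrite ler_wpM2r ?lerDl // mulr_ge0 // (le_trans _ lnS) // ltW.
rewrite !natrM.
have -> : a%:R * 3 / ln 2 * (S%:R * ln (S%:R : R)) =
  a%:R * (S%:R * (3 / ln 2 * ln (S%:R : R))) by ring.
by rewrite !ler_wpM2l.
Unshelve. all: by end_near. Qed.

Unset Implicit Arguments.

Theorem theorem4 (R : realType) :
  exists (c : prog) (T : nat -> nat),
    ((fun S : nat => (T S)%:R : R^o)
       =O_\oo (fun S : nat => S%:R * ln (S%:R : R) : R^o)) /\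
    (forall (n : nat) (pbar b : 'cV[R]_n.+1) (beta : R),
      simplex pbar ->
      (forall i, 0 < pbar i ord0) ->
      (forall i, 0 <= b i ord0) ->
      0 <= beta ->
      min_component b <= beta ->
      beta < dot b pbar ->
      exists (t : nat) (s : state R),
        [/\ exec c (input_state pbar b beta) t s,
            (t <= T n.+1)%N
          & is_projection_value (@phi_variation R) pbar b beta (output s)]).
Proof.
(* For [S] at least 1, [24 * S + 7] is at most [31 * S] and [13 * S + 13] at most [26 * S]; 57 is
   [31 + 26]. The successor covers [S = 1], where [up_log] vanishes. *)
exists projection_prog, (fun S => 57 * (S * (up_log 2 S).+1))%N.
split=> [|n pbar b beta pbarS pbar0 _ _ minb beta_lt].
  exact: natn_up_log_bigO.
have segE : seg (fun i => (col_entry b i, col_entry pbar i)) 0 n.+1 =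
    [seq (b i ord0, pbar i ord0) | i <- index_enum 'I_n.+1].
  rewrite /seg /index_iota subn0 -val_enum_ord -map_comp enumT.
  rewrite -[Finite.enum _]/(index_enum _).
  by apply: eq_map => i; rewrite /= /col_entry valK.
have [|t [s [e le [l [m [srt pe ml lem out]]]]]] :=
  @projection_prog_runs R n (col_entry pbar) (col_entry b) beta
    (input_state pbar b beta) erefl erefl erefl erefl erefl.
  by rewrite segE all_map; apply/allP => i _ /=.
exists t, s; split=> //.
  by apply: leq_trans le _; nia.
move: pe out; rewrite segE => pe out.
have [j mE] : exists j, m = b j ord0.
  move: ml; rewrite (perm_mem (perm_map fst pe)) -map_comp => /mapP[j _ ->].
  by exists j.
have bj i : b j ord0 <= b i ord0.
  rewrite -mE; apply: (allP lem (b i ord0, pbar i ord0)).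
  rewrite (perm_mem pe); apply: (map_f (fun i => (b i ord0, pbar i ord0))).
  exact: mem_index_enum.
rewrite out big_map mE.
have -> : \sum_i (b i ord0, pbar i ord0).1 * (b i ord0, pbar i ord0).2 = dot b pbar.
  by rewrite dotE.
apply: greedy_projection => //.
apply: le_trans minb; rewrite /min_component.
by apply: (big_ind (fun x => b j ord0 <= x)) => // x y h1 h2; rewrite le_min h1.
Qed.
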